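(* Let $q>p\geq1$ be integers, $G=\mathbf{SO}_0(p,q)$, $K=\mathbf{SO}(p)\times\mathbf{SO}(q)$, and let $X,Y\in\mathfrak{a}$ have configurations $[\mathbf{s};u]$ and $[\mathbf{t};v]$ respectively. If $X$ and $Y$ are not eligible, i.e. if $\max(\mathbf{s},2u)+\max(\mathbf{t},2v)>2p$, then the measure $\mu_{X,Y}$ is not absolutely continuous with respect to the Lebesgue measure on $\mathfrak{a}$.
   Context: $\mathbf{SO}_0(p,q)$ is the identity component of $\{g\in\mathbf{SL}(p+q,\mathbf{R}): g^TI_{p,q}g=I_{p,q}\}$, $I_{p,q}=\mathrm{diag}(-I_p,I_q)$; $K$ is its subgroup of block-diagonal matrices with blocks in $\mathbf{SO}(p)$ and $\mathbf{SO}(q)$. $\mathfrak{a}$ is the real vector space of matrices $$H=\begin{pmatrix}0_{p\times p}&\mathcal{D}_H&0\\ \mathcal{D}_H&0_{p\times p}&0\\0&0&0_{(q-p)\times(q-p)}\end{pmatrix},\quad \mathcal{D}_H=\mathrm{diag}[H_1,\dots,H_p],\ H_i\in\mathbf{R},$$ and the positive Weyl chamber is $\mathfrak{a}^+=\{H\in\mathfrak{a}:H_1>H_2>\dots>H_p>0\}$. The Cartan projection $a:G\to\overline{\mathfrak{a}^+}$ is defined by $g=k_1e^{a(g)}k_2$ with $k_1,k_2\in K$, $a(g)\in\overline{\mathfrak{a}^+}$. Let $m_K$ be the normalized Haar measure of $K$, viewed as a measure on $G$; for $X\in\mathfrak{a}$, $\delta_{e^X}^\natural=m_K\star\delta_{e^X}\star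 m_K$ (convolution of measures on $G$), and $m_{X,Y}=\delta_{e^X}^\natural\star\delta_{e^Y}^\natural$. The measure $\mu_{X,Y}$ is the projection of $m_{X,Y}$ on $\mathfrak{a}$ via the Cartan decomposition $G=KAK$, i.e. the image of $m_{X,Y}$ under the Cartan projection $a$ (whether or not one symmetrizes this image under the Weyl group, which acts by permutations and sign changes of the $H_i$, is immaterial for absolute continuity). Configuration: for $X\in\mathfrak{a}$, list the absolute values of the diagonal entries of $\mathcal{D}_X$ in decreasing order as $x_1$ repeated $s_1$ times, ..., $x_r$ repeated $s_r$ times, and $0$ repeated $u\ge0$ times, where $x_1>\dots>x_r>0$, $s_i\geq1$, and $\sum s_i+u=p$. Then $[\mathbf{s};u]=[s_1,\dots,s_r;u]$ is the configuration of $X$ (for $X=0$ it is $[0;p]$). For an integer $m$, $\max(\mathbf{s},m)=\max(\max_i s_i,m)$. *)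

(* Defs.v *)
From HB Require Import structures.
From mathcomp Require Import all_boot all_order all_algebra.
From mathcomp Require Import all_classical all_reals all_analysis.
From mathcomp Require Import measurable_realfun.

Set Implicit Arguments.
Unset Strict Implicit.
Unset Printing Implicit Defensive.

Import Order.TTheory GRing.Theory Num.Theory.
Import numFieldNormedType.Exports.

Local Open Scope classical_set_scope.
Local Open Scope ring_scope.

Definition mx_display : measure_display. Proof. exact. Qed.

Section borel_matrix.
Context (R : realType) (m n : nat).

Definition mx_borel : set (set 'M[R]_(m, n)) := <<s open >>.

Let mx_borelC A : mx_borel A -> mx_borel (~` A).
Proof. exact: sigma_algebraC. Qed.

HB.instance Definition _ := @isMeasurable.Build mx_display 'M[R]_(m, n)
  mx_borel (@sigma_algebra0 _ setT open) mx_borelC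
  (@sigma_algebra_bigcup _ setT open).

Lemma open_mx_measurable (U : set 'M[R]_(m, n)) : open U -> measurable U.
Proof. by move=> oU; exact: sub_sigma_algebra. Qed.

Lemma measurable_coord i j :
  measurable_fun setT (fun M : 'M[R]_(m, n) => M i j).
Proof.
apply: (measurability _ (RGenOpens.measurableE R)).
move=> _ [_ [a [b ->]] <-]; rewrite setTI; apply: open_mx_measurable.
have /continuousP : continuous (fun M : 'M[R]_(m, n) => M i j).
  exact: coord_continuous.
by apply; exact: interval_open.
Qed.

Lemma measurable_fun_mx d (T : measurableType d) (f : T -> 'M[R]_(m, n)) :
  (forall i j, measurable_fun setT (fun x => f x i j)) ->
  measurable_fun setT f.
Proof.
move=> mf.
pose box (Qk : 'M[rat]_(m, n) * nat) := [set M : 'M[R]_(m, n) |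
  forall i j, ball (ratr (Qk.1 i j) : R) (Qk.2.+1%:R^-1) (M i j)].
have mbox Qk : measurable (f @^-1` box Qk).
  have -> : f @^-1` box Qk = \big[setI/setT]_(ij : 'I_m * 'I_n)
      ((fun x => f x ij.1 ij.2) @^-1`
        ball (ratr (Qk.1 ij.1 ij.2) : R) (Qk.2.+1%:R^-1)).
    rewrite -bigcap_seq; apply/seteqP; split => x /=.
      by move=> xb [i j] _; exact: xb.
    by move=> xb i j; apply: (xb (i, j)); rewrite /= mem_index_enum.
  apply: bigsetI_measurable => ij _; rewrite -[X in measurable X]setTI.
  by apply: mf => //; apply: open_measurable; exact: ball_open.
suff oU U : open U -> measurable (f @^-1` U).
  have me : measurable = <<s open >> :> set (set 'M[R]_(m, n)) by [].
  by apply: (measurability _ me) => _ [U oU' <-]; rewrite setTI; exact: oU.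
move=> openU.
have -> : U = \bigcup_(Qk in [set Qk | box Qk `<=` U]) box Qk.
  apply/seteqP; split => [M UM|M [Qk /= QkU]]; last exact: QkU.
  have /nbhs_ballP[e /= e0 eU] : nbhs M U by exact: open_nbhs_nbhs.
  have [k ke] : exists k, k.+1%:R^-1 < e / 2.
    have e2 : 0 < e / 2 by rewrite divr_gt0.
    have [k _ kP] := near_infty_natSinv_lt (PosNum e2).
    by exists k; exact: (kP k (leqnn k)).
  have k0 : 0 < k.+1%:R^-1 :> R by rewrite invr_gt0.
  have ratP i j : exists q : rat, ball (ratr q : R) k.+1%:R^-1 (M i j).
    have := @dense_rat R (ball (M i j) k.+1%:R^-1).
    case.
    - by exists (M i j); exact: ballxx.
    - exact: ball_open.
    - by move=> y [/= yb [q _ qy]]; exists q; rewrite qy; exact: ball_sym.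
  pose Q := \matrix_(i, j) sval (cid (ratP i j)).
  exists (Q, k) => /=; last first.
    by move=> i j; rewrite mxE; case: cid.
  move=> N /= bN; apply: eU; split => // i j; apply: (@le_ball _ _ _ (e/2 + e/2)).
    by rewrite -splitr.
  apply: (@ball_triangle _ _ (ratr (Q i j) : R)).
    apply: (le_ball (ltW ke)); apply: ball_sym.
    by rewrite mxE; case: cid.
  by apply: (le_ball (ltW ke)); exact: bN.
rewrite preimage_bigcup bigcup_mkcond.
apply: countable_bigcupT_measurable; first exact: countableP.
by move=> Qk; case: ifPn.
Qed.

End borel_matrix.

Section convolution.
Context (R : realType) (n : nat).

Definition mulmx_pair (gh : 'M[R]_n * 'M[R]_n) : 'M[R]_n := gh.1 *m gh.2.

Let measurable_mulmx_pair : measurable_fun setT mulmx_pair.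
Proof.
apply: measurable_fun_mx => i j; rewrite /mulmx_pair.
under eq_fun do rewrite mxE.
apply: measurable_sum => k; apply: measurable_funM.
- exact: measurableT_comp (measurable_coord i k) measurable_fst.
- exact: measurableT_comp (measurable_coord k j) measurable_snd.
Qed.

HB.instance Definition _ := isMeasurableFun.Build _ _ _ _ mulmx_pair
  measurable_mulmx_pair.

Definition convolution (P Q : probability 'M[R]_n R) : probability 'M[R]_n R :=
  distribution (P \x Q)%E mulmx_pair.

End convolution.

Section lebesgue_rV_step.
Context (R : realType) (n : nat).

Definition rV_cons (xv : measurableTypeR R * 'rV[R]_n) : 'rV[R]_n.+1 :=
  row_mx (xv.1%:M : 'M[R]_1) xv.2.

Let measurable_rV_cons : measurable_fun setT rV_cons.
Proof.
apply: measurable_fun_mx => i j; rewrite /rV_cons.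
case: (@split_ordP 1 n j) => k jk.
  rewrite [X in measurable_fun _ X](_ : _ = fst); first exact: measurable_fst.
  apply/funext => -[x v]; rewrite jk.
  by rewrite (@row_mxEl R 1 1 n) !ord1 mxE eqxx mulr1n.
rewrite [X in measurable_fun _ X](_ : _ = (fun v : 'rV[R]_n => v i k) \o snd).
  exact: measurableT_comp (measurable_coord i k) measurable_snd.
by apply/funext => -[x v]; rewrite jk (@row_mxEr R 1 1 n).
Qed.

HB.instance Definition _ := isMeasurableFun.Build _ _ _ _ rV_cons
  measurable_rV_cons.

Variable nu : {sigma_finite_measure set 'rV[R]_n -> \bar R}.

Definition lebesgue_cons : set 'rV[R]_n.+1 -> \bar R :=
  pushforward (lebesgue_measure \x nu)%E rV_cons.

Let lebesgue_cons0 : lebesgue_cons set0 = 0%E.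
Proof. exact: measure0. Qed.

Let lebesgue_cons_ge0 A : (0 <= lebesgue_cons A)%E.
Proof. exact: measure_ge0. Qed.

Let lebesgue_cons_sigma_additive : semi_sigma_additive lebesgue_cons.
Proof. exact: measure_semi_sigma_additive. Qed.

HB.instance Definition _ := isMeasure.Build _ _ _ lebesgue_cons
  lebesgue_cons0 lebesgue_cons_ge0 lebesgue_cons_sigma_additive.

Let lebesgue_cons_sigma_finite : sigma_finite setT lebesgue_cons.
Proof.
pose uncons (v : 'rV[R]_n.+1) : measurableTypeR R * 'rV[R]_n :=
  (v ord0 ord0, \row_j v ord0 (lift ord0 j)).
have uncK : cancel rV_cons uncons.
  move=> [x v]; rewrite /uncons /rV_cons; congr (_, _).
    rewrite (_ : ord0 = lshift n (ord0 : 'I_1)); last exact/val_inj.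
    by rewrite (@row_mxEl R 1 1 n) mxE eqxx mulr1n.
  apply/rowP => j; rewrite mxE.
  rewrite (_ : lift ord0 j = rshift 1 j); last exact/val_inj.
  by rewrite (@row_mxEr R 1 1 n).
have munc : measurable_fun setT uncons.
  apply/measurable_fun_pairP; split; first exact: measurable_coord.
  apply: measurable_fun_mx => i j.
  rewrite [X in measurable_fun _ X](_ : _ =
    (fun v : 'rV[R]_n.+1 => v ord0 (lift ord0 j))).
    exact: measurable_coord.
  by apply/funext => v; rewrite /= mxE.
have [F FT Foo] : sigma_finite setT (lebesgue_measure \x nu)%E.
  have /sigma_finiteP[F [TF ndF Foo]] := sigma_finiteT (@lebesgue_measure R).
  have /sigma_finiteP[G [TG ndG Goo]] := sigma_finiteT nu.
  exists (fun k => F k `*` G k).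
    rewrite -setXTT TF TG predeqE => -[x y]; split.
      move=> [/= [i _ Fix] [k _ Gky]]; exists (maxn i k) => //; split.
      - by move: x Fix; exact/subsetPset/ndF/leq_maxl.
      - by move: y Gky; exact/subsetPset/ndG/leq_maxr.
    by move=> [i _ []/= ? ?]; split; exists i.
  move=> k; have [? ?] := Foo k; have [? ?] := Goo k.
  split; first exact: measurableX.
  by rewrite product_measure1E// lte_mul_pinfty// ge0_fin_numE.
exists (fun k => uncons @^-1` F k).
  by rewrite -preimage_bigcup -FT preimage_setT.
move=> k; have [mF Fk] := Foo k; split.
  by rewrite -[X in measurable X]setTI; exact: munc.
rewrite /lebesgue_cons /pushforward.
rewrite (_ : rV_cons @^-1` _ = F k)//.
by apply/seteqP; split => x /=; rewrite uncK.
Qed.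

HB.instance Definition _ := Measure_isSigmaFinite.Build _ _ _ lebesgue_cons
  lebesgue_cons_sigma_finite.

End lebesgue_rV_step.

Fixpoint lebesgue_rV (R : realType) (n : nat) :
    {sigma_finite_measure set 'rV[R]_n -> \bar R} :=
  match n with
  | 0 => \d_(0 : 'rV[R]_0)
  | n'.+1 => lebesgue_cons (lebesgue_rV R n')
  end.
Arguments lebesgue_rV {R} n.

Section SOpq.
Context (R : realType) (p q : nat).

Definition Ipq : 'M[R]_(p + q) := block_mx (- 1%:M) 0 0 1%:M.

Definition SOpq : set 'M[R]_(p + q) :=
  [set g | \det g = 1 /\ g^T *m Ipq *m g = Ipq].

Definition SO0pq : set 'M[R]_(p + q) := connected_component SOpq 1%:M.

Definition SO (n : nat) : set 'M[R]_n :=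
  [set k | k^T *m k = 1%:M /\ \det k = 1].

Definition Kpq : set 'M[R]_(p + q) :=
  [set g | exists k l, [/\ SO k, SO l & g = block_mx k 0 0 l]].

(* An element of the Cartan subspace is given by the row H of its coordinates
   H_1, ..., H_p; this is the p x q block (D_H, 0) of the matrix. *)
Definition cartan_block (H : 'rV[R]_p) : 'M[R]_(p, q) :=
  \matrix_(i, j) (H ord0 i *+ (i == j :> nat)).

Definition cartan_mx (H : 'rV[R]_p) : 'M[R]_(p + q) :=
  block_mx 0 (cartan_block H) (cartan_block H)^T 0.

Definition weyl_chamber : set 'rV[R]_p :=
  [set H | (forall i j : 'I_p, (i < j)%N -> H ord0 j < H ord0 i) /\
           (forall i : 'I_p, 0 < H ord0 i)].

Definition expmx (n : nat) (A : 'M[R]_n) : 'M[R]_n :=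
  limn (series (fun k => k`!%:R^-1 *: A ^+ k)).

(* The values of a outside of the group are irrelevant. *)
Definition is_cartan_projection (a : 'M[R]_(p + q) -> 'rV[R]_p) : Prop :=
  forall g, SO0pq g -> closure weyl_chamber (a g) /\
    exists k1 k2, [/\ Kpq k1, Kpq k2 & g = k1 *m expmx (cartan_mx (a g)) *m k2].

(* The normalized Haar measure of K, viewed as a measure on all matrices of
   size p + q: the unique left-invariant probability carried by K. *)
Definition is_haar_K (mK : probability 'M[R]_(p + q) R) : Prop :=
  mK Kpq = 1%E /\
  forall k A, Kpq k -> measurable A -> mK [set k *m x | x in A] = mK A.

Definition delta_natural (mK : probability 'M[R]_(p + q) R) (X : 'rV[R]_p) :
    probability 'M[R]_(p + q) R :=
  convolution (convolution mK \d_(expmx (cartan_mx X))) mK.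

Definition mXY (mK : probability 'M[R]_(p + q) R) (X Y : 'rV[R]_p) :
    probability 'M[R]_(p + q) R :=
  convolution (delta_natural mK X) (delta_natural mK Y).

(* mXY is carried by SO0pq, the domain of the Cartan projection. *)
Definition muXY (mK : probability 'M[R]_(p + q) R)
    (a : 'M[R]_(p + q) -> 'rV[R]_p) (X Y : 'rV[R]_p) : set 'rV[R]_p -> \bar R :=
  fun A => mXY mK X Y (SO0pq `&` a @^-1` A).

End SOpq.

Section configuration.
Context (R : realType) (p : nat).

Definition abs_entries (X : 'rV[R]_p) : seq R :=
  sort >=%R [seq `|X ord0 i| | i : 'I_p].

(* undup preserves the decreasing order of abs_entries X *)
Definition configuration (X : 'rV[R]_p) : seq nat * nat :=
  (if X == 0 then [:: 0%N]
   else [seq count_mem x (abs_entries X) | x <- undup (abs_entries X) & x != 0],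
   count_mem 0 (abs_entries X)).

End configuration.

Definition max_conf (s : seq nat) (m : nat) : nat := maxn (\max_(i <- s) i) m.

(* Main.v *)
Require Import Defs.
From HB Require Import structures.
From mathcomp Require Import all_boot all_order all_algebra.
From mathcomp Require Import all_classical all_reals all_analysis.
From mathcomp Require Import ring lra zify.

Set Implicit Arguments.
Unset Strict Implicit.
Unset Printing Implicit Defensive.

Import Order.TTheory GRing.Theory Num.Theory.
Import numFieldNormedType.Exports.

Local Open Scope classical_set_scope.
Local Open Scope ring_scope.

(** Write g = k1 e^X k2 e^Y k3 with all k's in K, and H = a(g).

    If u + v > p, the upper right p x q block of g has rank at most
    (p - u) + (p - v) < p, whereas the same block of k e^H k' has p singular
    values |sinh H_i|; hence some H_i vanishes.  If x > 0 has multiplicity s in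
    |X| and s + 2v > 2p, then e^(2x) is an eigenvalue of g g^T: up to
    conjugation by k1,
      g g^T - e^(2x) = e^X (k2 e^(2Y) k2^T - 1) e^X + (e^(2X) - e^(2x)),
    and the two terms have ranks at most 2(p - v) and p + q - s.  The
    eigenvalues of g g^T being the e^(+-2 H_i) and 1, some |H_i| is x.  The
    remaining case is symmetric.  In all cases mu_(X,Y) is carried by a
    Lebesgue-null union of hyperplanes |H_i| = x.

    That g lies in the identity component, where a is constrained, follows from
    the connectedness of SO(n): a rotation is a product of an even number of
    reflections, and a product of two reflections is joined to 1 by moving one
    mirror onto the other. *)

(** * Entrywise topology of matrices: continuity, closedness, measurability *)

Section matrix_topology.
Context (R : realType).

(** A neighbourhood of a matrix contains a box of neighbourhoods of its finitely many entries, and a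
    filter is stable under finite intersections. *)
Lemma cvg_mx m n (T : Type) (F : set_system T) (FF : Filter F)
    (f : T -> 'M[R]_(m, n)) (M : 'M[R]_(m, n)) :
  (forall i j, f x i j @[x --> F] --> M i j) -> f x @[x --> F] --> M.
Proof.
move=> cf B [P MP PB].
have : F [set x | forall i j, P i j (f x i j)].
  by apply: filter_forall => i; apply: filter_forall => j; exact: cf (MP i j).
move=> FP; apply: (filterS _ FP) => x; exact: PB.
Qed.

Lemma continuous_mx m n (T : topologicalType) (f : T -> 'M[R]_(m, n)) :
  (forall i j, continuous (fun x => f x i j)) -> continuous f.
Proof. by move=> cf x; apply: cvg_mx => i j; exact: cf. Qed.

Lemma continuous_entry m n (T : topologicalType) (f : T -> 'M[R]_(m, n)) i j :
  continuous f -> continuous (fun x => f x i j).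
Proof.
move=> cf x; apply: (@continuous_comp _ _ _ f (fun M => M i j)); first exact: cf.
exact: coord_continuous.
Qed.

Lemma continuous_sumr (T : topologicalType) (I : Type) (r : seq I)
    (F : I -> T -> R) :
  (forall i, continuous (F i)) -> continuous (fun x => \sum_(i <- r) F i x).
Proof. by move=> cF; apply: (continuous_big add_continuous). Qed.

Lemma continuous_prodr (T : topologicalType) (I : Type) (r : seq I)
    (F : I -> T -> R) :
  (forall i, continuous (F i)) -> continuous (fun x => \prod_(i <- r) F i x).
Proof. by move=> cF; apply: (continuous_big mul_continuous). Qed.

Lemma continuous_mulmx m n k (T : topologicalType) (f : T -> 'M[R]_(m, n))
    (g : T -> 'M[R]_(n, k)) :
  continuous f -> continuous g -> continuous (fun x => f x *m g x).
Proof.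
move=> cf cg; apply: continuous_mx => i j; under eq_fun do rewrite mxE.
by apply: continuous_sumr => l x; apply: cvgM;
  [exact: continuous_entry cf _ | exact: continuous_entry cg _].
Qed.

Lemma continuous_addmx m n (T : topologicalType) (f g : T -> 'M[R]_(m, n)) :
  continuous f -> continuous g -> continuous (fun x => f x + g x).
Proof.
move=> cf cg; apply: continuous_mx => i j; under eq_fun do rewrite mxE.
by move=> x; apply: cvgD;
  [exact: continuous_entry cf _ | exact: continuous_entry cg _].
Qed.

Lemma continuous_scalemx m n (T : topologicalType) (c : T -> R)
    (f : T -> 'M[R]_(m, n)) :
  continuous c -> continuous f -> continuous (fun x => c x *: f x).
Proof.
move=> cc cf; apply: continuous_mx => i j; under eq_fun do rewrite mxE.
by move=> x; apply: cvgM; [exact: cc | exact: continuous_entry cf _].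
Qed.

Lemma continuous_trmx m n (T : topologicalType) (f : T -> 'M[R]_(m, n)) :
  continuous f -> continuous (fun x => (f x)^T).
Proof.
move=> cf; apply: continuous_mx => i j; under eq_fun do rewrite mxE.
exact: continuous_entry.
Qed.

Lemma continuous_det n (T : topologicalType) (f : T -> 'M[R]_n) :
  continuous f -> continuous (fun x => \det (f x)).
Proof.
move=> cf; apply: continuous_sumr => s x.
apply: cvgM; first exact: cvg_cst.
by apply: continuous_prodr => i; exact: continuous_entry.
Qed.

Lemma continuous_block_mx m1 m2 n1 n2 (T : topologicalType)
    (a : T -> 'M[R]_(m1, n1)) (b : T -> 'M[R]_(m1, n2))
    (c : T -> 'M[R]_(m2, n1)) (d : T -> 'M[R]_(m2, n2)) :
  continuous a -> continuous b -> continuous c -> continuous d ->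
  continuous (fun x => block_mx (a x) (b x) (c x) (d x)).
Proof.
move=> ca cb cc cd; apply: continuous_mx => i j.
case: (split_ordP i) => i' ->; case: (split_ordP j) => j' ->.
- by under eq_fun do rewrite block_mxEul; exact: continuous_entry.
- by under eq_fun do rewrite block_mxEur; exact: continuous_entry.
- by under eq_fun do rewrite block_mxEdl; exact: continuous_entry.
- by under eq_fun do rewrite block_mxEdr; exact: continuous_entry.
Qed.

Lemma closed_level_set (T : topologicalType) (V : normedModType R)
    (f : T -> V) (y : V) :
  continuous f -> closed [set x | f x = y].
Proof.
move=> cf; have /continuous_closedP/(_ [set y]) := cf; apply.
by apply: accessible_closed_set1; apply: hausdorff_accessible;
  exact: norm_hausdorff.
Qed.

Lemma closed_mx_measurable m n (A : set 'M[R]_(m, n)) :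
  closed A -> measurable A.
Proof.
by move=> /closed_openC oA; rewrite -(setCK A); apply: measurableC;
  exact: open_mx_measurable.
Qed.

End matrix_topology.

(** * Supports of convolutions of probability measures *)

Section full_sets.
Context (R : realType) (n : nat).

(* The product of two measurable sets need not be measurable, so a set is
   called full when all its measurable supersets have probability one. *)
Definition full (P : probability 'M[R]_n R) (A : set 'M[R]_n) : Prop :=
  forall C, measurable C -> A `<=` C -> P C = 1%E.

Lemma full_measurable (P : probability 'M[R]_n R) A :
  measurable A -> P A = 1%E -> full P A.
Proof.
move=> mA PA C mC AC; apply/eqP; rewrite eq_le probability_le1//= -PA.
by apply: le_measure => //; rewrite inE.
Qed.

Lemma full_dirac (x : 'M[R]_n) : full \d_x [set x].
Proof.
by move=> C mC xC; rewrite /= diracE mem_set//; exact: xC.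
Qed.

(** Fubini: if [C] contains all products, then for every g in [A] the section of h with g h in [C]
    contains [B] and has [Q]-measure one. The set of such g is measurable and contains [A], so the
    integrand defining the product measure is 1 almost everywhere. *)
Lemma full_convolution (P Q : probability 'M[R]_n R) (A B : set 'M[R]_n) :
  full P A -> full Q B ->
  full (convolution P Q) [set x | exists g h, [/\ A g, B h & x = g *m h]].
Proof.
move=> fA fB C mC ABC.
have mm : measurable (@mulmx_pair R n @^-1` C).
  by rewrite -[X in measurable X]setTI; exact: measurable_funP.
have := measurable_fun_xsection Q mm.
set phi := (_ \o _) => mphi.
have phiE g : phi g = Q [set h | C (g *m h)].
  by rewrite /phi /=; congr (Q _); apply/seteqP; split => h;
    rewrite /xsection /= inE.
have m1 : measurable (phi @^-1` [set 1%E]).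
  by rewrite -[X in measurable X]setTI; apply: mphi => //;
    exact: emeasurable_set1.
have P1 : P (phi @^-1` [set 1%E]) = 1%E.
  apply: fA => // g Ag; rewrite /= phiE; apply: fB.
    have := measurable_xsection g mm.
    by congr measurable; apply/seteqP; split => h; rewrite /xsection /= inE.
  by move=> h Bh; apply: ABC; exists g, h.
rewrite /convolution /distribution /pushforward /= /product_measure1.
rewrite (ae_eq_integral (cst 1%E))//.
  by rewrite integral_cst// mul1e; exact: probability_setT.
exists (~` (phi @^-1` [set 1%E])); split => //; first exact: measurableC.
  by have := probability_setC P m1; rewrite P1 subee.
by move=> g h1 h2; apply: h1 => _; exact: h2.
Qed.

End full_sets.

(** * Exponential of a diagonalizable matrix *)

Section expmx_diag.
Context (R : realType).

(** The inner factors [V *m U] cancel in every power, so each entry of a partial sum is a fixed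
    finite linear combination of partial sums of scalar exponential series. *)
Lemma expmx_conj_diag n (U V : 'M[R]_n) (d : 'rV[R]_n) : U *m V = 1%:M ->
  expmx (U *m diag_mx d *m V) = U *m diag_mx (map_mx expR d) *m V.
Proof.
move=> UV; have VU := mulmx1C UV.
have powE k : (U *m diag_mx d *m V) ^+ k =
    U *m diag_mx (map_mx (fun x => x ^+ k) d) *m V.
  elim: k => [|k IH].
    rewrite expr0 (_ : map_mx _ _ = const_mx 1).
      by rewrite diag_const_mx mulmx1 UV.
    by apply/rowP => j; rewrite !mxE expr0.
  rewrite exprSr IH -mulmxE -!mulmxA (mulmxA V U) VU mul1mx.
  rewrite (mulmxA (diag_mx _)) mulmx_diag; congr (_ *m (diag_mx _ *m _)).
  by apply/rowP => j; rewrite !mxE exprSr.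
have entryE (f : 'rV[R]_n) i j : (U *m diag_mx f *m V) i j =
    \sum_l (U i l * V l j) * f ord0 l.
  rewrite mxE; apply: eq_bigr => l _; rewrite mul_mx_diag mxE.
  by rewrite mulrAC.
apply: cvg_lim; first exact: norm_hausdorff.
apply: cvg_mx => i j; rewrite entryE.
rewrite (_ : (fun N => _) = fun N =>
    \sum_l (U i l * V l j) * series (exp_coeff (d ord0 l)) N).
  apply: (cvg_big add_continuous) => l _; rewrite mxE; apply: cvgMr.
  exact: is_cvg_series_exp_coeff.
apply/funext => N; rewrite summxE.
under eq_bigr => k _ do rewrite powE mxE entryE mulr_sumr.
rewrite exchange_big /=; apply: eq_bigr => l _.
rewrite mulr_sumr; apply: eq_bigr => k _.
by rewrite mxE mulrCA /exp_coeff /= [k`!%:R^-1 * _]mulrC.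
Qed.

End expmx_diag.

(** * Simultaneous diagonalization of the Cartan subspace and its exponential *)

Section cartan_exponential.
Context (R : realType) (p q : nat).
Hypothesis hpq : (p <= q)%N.

Local Notation J := (@pid_mx R p q p).
Local Notation Pr := (@pid_mx R q q p).
Local Notation c := (Num.sqrt 2%:R^-1 : R).

(** Extension by zeros to length q: [insub] fails for j >= p, and [oapp] then returns 0. *)
Definition cartan_pad (H : 'rV[R]_p) : 'rV[R]_q :=
  \row_j oapp (H ord0) 0 (insub (j : nat)).

(** Eigenvalues in the order of the columns of the eigenbasis below: H_i for e_i + f_i, then -H_i
    for e_i - f_i, and 0 for f_j with j > p. *)
Definition cartan_spec (H : 'rV[R]_p) : 'rV[R]_(p + q) :=
  row_mx H (- cartan_pad H).

(* The symmetric orthogonal matrix whose columns are the eigenvectors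
   (e_i +- f_i) / sqrt 2 and f_j, j > p, common to all matrices of the Cartan
   subspace. *)
Definition cartan_basis : 'M[R]_(p + q) :=
  block_mx c%:M (c *: J) (c *: J^T) (1%:M - (1 + c) *: Pr).

Local Notation U := cartan_basis.

Lemma cartan_pad_widen H (i : 'I_p) : cartan_pad H ord0 (widen_ord hpq i) = H ord0 i.
Proof. by rewrite mxE /= valK. Qed.

Lemma cartan_pad_out H (j : 'I_q) : (p <= j)%N -> cartan_pad H ord0 j = 0.
Proof. by move=> pj; rewrite mxE insubF//= ltnNge pj. Qed.

Let JJT : J *m J^T = 1%:M.
Proof. by rewrite tr_pid_mx mul_pid_mx minnn (minn_idPr hpq) pid_mx_1. Qed.

Let JTJ : J^T *m J = Pr.
Proof. by rewrite tr_pid_mx mul_pid_mx !minnn. Qed.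

Let JPr : J *m Pr = J.
Proof. by rewrite -JTJ mulmxA JJT mul1mx. Qed.

Let PrJT : Pr *m J^T = J^T.
Proof. by rewrite -JTJ -mulmxA JJT mulmx1. Qed.

Let PrPr : Pr *m Pr = Pr.
Proof. by rewrite -{1}JTJ -mulmxA JPr JTJ. Qed.

Let cc : c * c = 2%:R^-1.
Proof. by rewrite -expr2 sqr_sqrtr// invr_ge0. Qed.

(** The lower right block of the basis acts as -c on the first p coordinates and as the identity on
    the others; [J] only sees the former. *)
Let JW : J *m (1%:M - (1 + c) *: Pr) = - c *: J.
Proof.
by rewrite mulmxBr mulmx1 -scalemxAr JPr scalerDl scale1r opprD addNKr scaleNr.
Qed.

Let WJT : (1%:M - (1 + c) *: Pr) *m J^T = - c *: J^T.
Proof.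
by rewrite mulmxBl mul1mx -scalemxAl PrJT scalerDl scale1r opprD addNKr scaleNr.
Qed.

Let WW : (1%:M - (1 + c) *: Pr) *m (1%:M - (1 + c) *: Pr) =
  1%:M - 2%:R^-1 *: Pr.
Proof.
rewrite mulmxBr mulmx1 mulmxBl mul1mx -!scalemxAr -scalemxAl PrPr.
transitivity (1%:M - ((1 + c) + (1 + c) - (1 + c) * (1 + c)) *: Pr).
  by apply/matrixP => i j; rewrite !mxE; ring.
by congr (_ - _ *: _); have := cc; lra.
Qed.

Lemma cartan_basis_invol : U *m U = 1%:M.
Proof.
rewrite scalar_mx_block mulmx_block; congr block_mx.
- rewrite -scalar_mxM cc -scalemxAl -scalemxAr JJT scalerA cc scalemx1 -raddfD.
  by congr (_%:M); lra.
- by rewrite mul_scalar_mx -scalemxAl JW scaleNr scalerN subrr.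
- by rewrite mul_mx_scalar -scalemxAr WJT scaleNr scalerN subrr.
- by rewrite -scalemxAl -scalemxAr JTJ WW scalerA cc addrC subrK.
Qed.

Lemma cartan_basis_sym : U^T = U.
Proof.
have tW : (1%:M - (1 + c) *: Pr)^T = 1%:M - (1 + c) *: Pr.
  by rewrite raddfB /= linearZ /= tr_scalar_mx tr_pid_mx.
rewrite tr_block_mx tW tr_scalar_mx [(c *: J)^T]linearZ [(c *: J^T)^T]linearZ.
by rewrite /= trmxK.
Qed.

Lemma diag_mx_pid (h : 'rV[R]_p) : diag_mx h *m J = cartan_block q h.
Proof.
apply/matrixP => i j; rewrite mul_diag_mx !mxE ltn_ord andbT.
by rewrite mulr_natr.
Qed.

Lemma pid_diag_mx (f : R -> R) (h : 'rV[R]_p) :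
  J *m diag_mx (map_mx f (cartan_pad h)) = diag_mx (map_mx f h) *m J.
Proof.
apply/matrixP => i j; rewrite mul_diag_mx mul_mx_diag !mxE ltn_ord andbT mulrC.
by have [<-|] := eqVneq (val i) (val j); rewrite /= ?mulr0// valK.
Qed.

(** The projector [1%:M - Pr] lives on the coordinates j >= p, where the padding is 0 and [f] takes
    the value 1. *)
Lemma diag_pad_coproj (f : R -> R) (h : 'rV[R]_p) : f 0 = 1 ->
  diag_mx (map_mx f (cartan_pad h)) *m (1%:M - Pr) = 1%:M - Pr.
Proof.
move=> f0; apply/matrixP => i j; rewrite mul_diag_mx !mxE.
rewrite -val_eqE /=; case: eqP => [->|_] /=; last by rewrite subrr mulr0.
case: ltnP => jp; first by rewrite subrr mulr0.
by rewrite insubF ?ltnNge ?jp//= f0 mul1r.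
Qed.

Lemma diag_cartan_pad (h : 'rV[R]_p) :
  diag_mx (cartan_pad h) = J^T *m diag_mx h *m J.
Proof.
have := pid_diag_mx id h; rewrite !map_mx_id// -mulmxA => <-.
rewrite mulmxA JTJ; apply/matrixP => i j; rewrite mul_mx_diag !mxE.
rewrite -[i == j]val_eqE /=; case: eqP => [->|_] /=; last by rewrite mul0r.
case: ltnP => jp; first by rewrite mul1r.
by rewrite mul0r insubF ?ltnNge ?jp.
Qed.

(** The contributions of H_i and -H_i cancel in the diagonal blocks and add up in the off-diagonal
    ones, with total weight 2 c^2 = 1. *)
Lemma cartan_mxE (H : 'rV[R]_p) :
  cartan_mx q H = U *m diag_mx (cartan_spec H) *m U.
Proof.
rewrite /cartan_spec diag_mx_row raddfN /= diag_cartan_pad /cartan_mx -diag_mx_pid.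
rewrite trmx_mul tr_diag_mx !mulmx_block !(mulmx0, mul0mx, addr0, add0r).
congr block_mx.
- rewrite mul_mx_scalar mul_scalar_mx mulmxN mulNmx -!(scalemxAl, scalemxAr).
  rewrite -!mulmxA JJT mulmx1 (mulmxA J) JJT mul1mx scalerA.
  by rewrite subrr.
- rewrite mul_scalar_mx mulmxN mulNmx -!(scalemxAl, scalemxAr).
  rewrite -!mulmxA JW (mulmxA J) JJT mul1mx -scalemxAr !scalerA mulrN scaleNr.
  by rewrite opprK cc -scalerDl (_ : _ + _ = 1) ?scale1r//; lra.
- rewrite mul_mx_scalar mulmxN mulNmx -!(scalemxAl, scalemxAr).
  rewrite !mulmxA WJT -!mulmxA JJT mulmx1 -scalemxAl !scalerA mulrN scaleNr.
  by rewrite opprK cc -scalerDl (_ : _ + _ = 1) ?scale1r//; lra.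
- rewrite mulmxN mulNmx -!(scalemxAl, scalemxAr).
  rewrite !mulmxA WJT -!mulmxA JW -!(scalemxAl, scalemxAr).
  by rewrite !scalerA mulrNN subrr.
Qed.

Definition cartan_exp (H : 'rV[R]_p) : 'M[R]_(p + q) := expmx (cartan_mx q H).

Lemma cartan_expE (H : 'rV[R]_p) :
  cartan_exp H = U *m diag_mx (map_mx expR (cartan_spec H)) *m U.
Proof.
by rewrite /cartan_exp cartan_mxE expmx_conj_diag//; exact: cartan_basis_invol.
Qed.

Lemma trmx_cartan_exp (H : 'rV[R]_p) : (cartan_exp H)^T = cartan_exp H.
Proof.
by rewrite cartan_expE !trmx_mul tr_diag_mx !cartan_basis_sym mulmxA.
Qed.

Let expN (H : 'rV[R]_p) : map_mx expR (- cartan_pad H) =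
  map_mx (fun x => expR (- x)) (cartan_pad H).
Proof. by apply/rowP => j; rewrite !mxE. Qed.

(** The entries are sinh H_i: the eigenvalues e^(H_i) and e^(-H_i) enter this block with the
    opposite weights c^2 and -c^2, where c^2 = 1/2. *)
Lemma ursubmx_cartan_exp (H : 'rV[R]_p) : ursubmx (cartan_exp H) =
  cartan_block q (map_mx (fun x => (expR x - expR (- x)) / 2) H).
Proof.
rewrite cartan_expE map_row_mx diag_mx_row expN !mulmx_block.
rewrite !(mulmx0, mul0mx, addr0, add0r) block_mxKur.
rewrite mul_scalar_mx -!(scalemxAl, scalemxAr) scalerA cc pid_diag_mx.
rewrite -mulmxA JW -scalemxAr scalerA mulrN cc scaleNr -scalerBr -mulmxBl.
rewrite -raddfB /= diag_mx_pid; apply/matrixP => i j; rewrite !mxE.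
by rewrite mulrnAr mulrC.
Qed.

(** In the eigenbasis the quadratic form becomes [S], which pairs the eigenvector of H_i with that
    of -H_i; the scalings e^(H_i) and e^(-H_i) compensate each other, and the vectors f_j with j > p
    are fixed. *)
Lemma cartan_exp_Ipq (H : 'rV[R]_p) :
  cartan_exp H *m Ipq R p q *m cartan_exp H = Ipq R p q.
Proof.
pose S : 'M[R]_(p + q) := block_mx 0 (- J) (- J^T) (1%:M - Pr).
have US : U *m Ipq R p q *m U = S.
  rewrite !mulmx_block !(mulmx0, mul0mx, addr0, add0r) !(mulmxN, mulmx1).
  congr block_mx.
  - rewrite mulNmx -scalar_mxM -!(scalemxAl, scalemxAr) JJT scalerA scalemx1.
    by rewrite addNr.
  - rewrite mulNmx mul_scalar_mx -!(scalemxAl, scalemxAr) JW !scalerA.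
    by rewrite mulrN scaleNr -opprD -scalerDl cc (_ : _ + _ = 1) ?scale1r//; lra.
  - rewrite mulNmx mul_mx_scalar -!(scalemxAl, scalemxAr) WJT !scalerA.
    by rewrite mulrN scaleNr -opprD -scalerDl cc (_ : _ + _ = 1) ?scale1r//; lra.
  - rewrite mulNmx -!(scalemxAl, scalemxAr) JTJ WW scalerA cc addrCA.
    by rewrite -opprD -scalerDl (_ : _ + _ = 1) ?scale1r//; lra.
have SU : Ipq R p q = U *m S *m U.
  rewrite -US -!mulmxA cartan_basis_invol mulmx1 mulmxA cartan_basis_invol.
  by rewrite mul1mx.
set D := diag_mx (map_mx expR (cartan_spec H)).
suff DS : D *m S *m D = S.
  rewrite {1}SU cartan_expE -/D -!mulmxA (mulmxA U U) cartan_basis_invol mul1mx.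
  rewrite (mulmxA U U) cartan_basis_invol mul1mx (mulmxA S) (mulmxA D) (mulmxA D).
  by rewrite DS mulmxA -SU.
have eN : diag_mx (map_mx expR H) *m diag_mx (map_mx (fun x => expR (- x)) H)
    = 1%:M.
  rewrite mulmx_diag -diag_const_mx; congr diag_mx; apply/rowP => j.
  by rewrite !mxE -expRD subrr expR0.
have DJ := pid_diag_mx (fun x => expR (- x)) H.
rewrite /D map_row_mx diag_mx_row expN !mulmx_block.
rewrite !(mulmx0, mul0mx, addr0, add0r).
congr block_mx.
- by rewrite mulmxN mulNmx -mulmxA DJ mulmxA eN mul1mx.
- apply: trmx_inj; rewrite !(mulmxN, mulNmx) !linearN /= trmxK.
  by rewrite !trmx_mul !tr_diag_mx trmxK mulmxA -mulmxA DJ mulmxA eN mul1mx.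
- rewrite diag_pad_coproj; last by rewrite oppr0 expR0.
  apply: trmx_inj; rewrite trmx_mul tr_diag_mx.
  have PT : (1%:M - Pr)^T = 1%:M - Pr by rewrite raddfB /= tr_scalar_mx tr_pid_mx.
  by rewrite PT diag_pad_coproj// oppr0 expR0.
Qed.

Lemma det_cartan_exp_gt0 (H : 'rV[R]_p) : 0 < \det (cartan_exp H).
Proof.
rewrite cartan_expE !det_mulmx mulrAC -det_mulmx cartan_basis_invol det1 mul1r.
by rewrite det_diag; apply: prodr_gt0 => j _; rewrite mxE expR_gt0.
Qed.

End cartan_exponential.

(** * Reflections and the generation of SO(n) *)

Section reflections.
Context (R : realType) (n : nat).
Implicit Types (u v w a b : 'cV[R]_n).

Definition dot u v : R := (u^T *m v) ord0 ord0.

Definition reflection v : 'M[R]_n := 1%:M - (2 / dot v v) *: (v *m v^T).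

Lemma dotC u v : dot u v = dot v u.
Proof. by rewrite /dot -[u^T *m v]trmxK trmx_mul trmxK mxE. Qed.

Lemma dotE u v : u^T *m v = (dot u v)%:M.
Proof. exact: mx11_scalar. Qed.

Lemma dotDr u v w : dot u (v + w) = dot u v + dot u w.
Proof. by rewrite /dot mulmxDr mxE. Qed.

Lemma dotNr u v : dot u (- v) = - dot u v.
Proof. by rewrite /dot mulmxN mxE. Qed.

Lemma dotZr u c v : dot u (c *: v) = c * dot u v.
Proof. by rewrite /dot -scalemxAr mxE. Qed.

Lemma dot_eq0 v : (dot v v == 0) = (v == 0).
Proof.
apply/eqP/eqP => [|->]; last by rewrite /dot mulmx0 mxE.
rewrite /dot mxE => /eqP; rewrite psumr_eq0 => [/allP v0|i _]; last first.
  by rewrite mxE -expr2 sqr_ge0.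
apply/colP => i; rewrite mxE; apply/eqP.
have := v0 i (mem_index_enum i); rewrite mxE -expr2 sqrf_eq0.
by [].
Qed.

Lemma mul_reflection v a : reflection v *m a = a - (2 * dot v a / dot v v) *: v.
Proof.
rewrite mulmxBl mul1mx -scalemxAl -mulmxA dotE mul_mx_scalar scalerA.
by rewrite mulrAC.
Qed.

Lemma reflection_orthogonal v a : dot v a = 0 -> reflection v *m a = a.
Proof. by move=> va; rewrite mul_reflection va mulr0 mul0r scale0r subr0. Qed.

(** Equal norms give 2 <a - b, a> = <a - b, a - b>, so the reflection subtracts exactly a - b from
    a. *)
Lemma reflection_sub a b : dot a a = dot b b -> a != b ->
  reflection (a - b) *m a = b.
Proof.
move=> ab; rewrite -subr_eq0 -dot_eq0 mul_reflection => w0.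
rewrite (_ : 2 * dot (a - b) a = dot (a - b) (a - b)).
  by rewrite divff// scale1r opprB addrC subrK.
rewrite dotC [RHS]dotDr !dotNr ![dot (a - b) _]dotC !dotDr !dotNr (dotC b a).
by rewrite ab; ring.
Qed.

Lemma reflection_sym v : (reflection v)^T = reflection v.
Proof. by rewrite raddfB /= linearZ /= trmx_mul trmxK tr_scalar_mx. Qed.

Lemma reflection_invol v : v != 0 -> reflection v *m reflection v = 1%:M.
Proof.
rewrite -dot_eq0 => v0; rewrite {2}/reflection mulmxBr mulmx1 -scalemxAr mulmxA.
rewrite mul_reflection mulfK// mulmxBl -scalemxAl.
by apply/matrixP => i j; rewrite !mxE; ring.
Qed.

Lemma reflectionZ c v : c != 0 -> reflection (c *: v) = reflection v.
Proof.
move=> c0; rewrite /reflection dotZr dotC dotZr; congr (_ - _).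
rewrite linearZ /= -scalemxAr -scalemxAl !scalerA; congr (_ *: _).
(* When [dot v v] is 0 both coefficients vanish, the inverse of 0 being 0. *)
have [->|v0] := eqVneq (dot v v) 0; first by rewrite !mulr0 invr0 mulr0 !mul0r.
by field; rewrite v0 c0.
Qed.

(** Sylvester's identity: multiplying [M] by the unipotent [L] on either side gives a block
    triangular matrix, and the two products have the same determinant. *)
Lemma det_sub1_mulmx m (A : 'M[R]_(n, m)) (B : 'M[R]_(m, n)) :
  \det (1%:M - A *m B) = \det (1%:M - B *m A).
Proof.
pose L : 'M[R]_(n + m) := block_mx 1%:M 0 (- B) 1%:M.
pose M : 'M[R]_(n + m) := block_mx 1%:M A B 1%:M.
have ML : M *m L = block_mx (1%:M - A *m B) A 0 1%:M.
  by rewrite mulmx_block !(mulmx0, mulmx1, mul1mx, mulmxN, add0r) subrr.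
have LM : L *m M = block_mx 1%:M A 0 (1%:M - B *m A).
  rewrite mulmx_block !(mul0mx, mulmx1, mul1mx, mulNmx, addr0) addNr.
  by rewrite [- _ + _]addrC.
have <- : \det (M *m L) = \det (1%:M - A *m B).
  by rewrite ML det_ublock det1 mulr1.
have <- : \det (L *m M) = \det (1%:M - B *m A).
  by rewrite LM det_ublock det1 mul1r.
by rewrite !det_mulmx mulrC.
Qed.

(** Sylvester's identity reduces this rank-one perturbation of the identity to the 1 x 1 determinant
    1 - 2. *)
Lemma det_reflection v : v != 0 -> \det (reflection v) = -1.
Proof.
rewrite -dot_eq0 => v0; rewrite /reflection scalemxAl det_sub1_mulmx.
rewrite -scalemxAr dotE scale_scalar_mx divfK// -raddfB /= det_scalar1; ring.
Qed.

(* Cartan-Dieudonne: composing k with the reflection along k e_i - e_i makes it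
   fix one more basis vector, so k is a product of reflections; only the parity
   of their number is recorded. *)
Lemma orthogonal_reflections (P : set 'M[R]_n) :
  P 1%:M ->
  (forall A B, P A -> P B -> P (A *m B)) ->
  (forall u v, u != 0 -> v != 0 -> P (reflection u *m reflection v)) ->
  forall k : 'M[R]_n, k^T *m k = 1%:M ->
    P k \/ exists2 v, v != 0 & P (reflection v *m k).
Proof.
move=> P1 PM PR.
(* Induction on the number [m] of trailing basis vectors that k may still move. *)
suff main m (k : 'M[R]_n) : (m <= n)%N ->
    (forall i : 'I_n, (i < n - m)%N -> col i k = delta_mx i 0) ->
    k^T *m k = 1%:M -> P k \/ exists2 v, v != 0 & P (reflection v *m k).
  by move=> k; apply: (main n) => // i; rewrite subnn.
elim: m k => [|m IH] k mn kfix kk.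
  rewrite (_ : k = 1%:M); first by left.
  apply/matrixP => i j; have := kfix j; rewrite subn0 => /(_ (ltn_ord j)).
  by move=> /matrixP/(_ i 0); rewrite !mxE andbT.
have i0P : (n - m.+1 < n)%N by rewrite -subSn// subSS leq_subr.
pose i0 := Ordinal i0P.
have dcol (k' : 'M[R]_n) (i j : 'I_n) : k'^T *m k' = 1%:M ->
    dot (col i k') (col j k') = (i == j)%:R.
  move=> k'k'; have := congr1 (fun M : 'M[R]_n => M i j) k'k'.
  rewrite !mxE => <-; rewrite /dot mxE; apply: eq_bigr => l _.
  by rewrite !mxE.
have next k' : (forall i : 'I_n, (i < n - m.+1)%N -> col i k' = delta_mx i 0) ->
    col i0 k' = delta_mx i0 0 ->
    forall i : 'I_n, (i < n - m)%N -> col i k' = delta_mx i 0.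
  move=> h1 h2 i; rewrite (_ : (n - m)%N = (n - m.+1).+1); last by rewrite subnSK.
  rewrite ltnS leq_eqVlt => /orP[/eqP ii|]; last exact: h1.
  by rewrite (_ : i = i0)//; exact: val_inj.
have [e0|w0] := eqVneq (col i0 k) (delta_mx i0 0).
  by apply: IH => //; [exact: ltnW|exact: next].
set w := col i0 k - delta_mx i0 0.
have w0' : w != 0 by rewrite subr_eq0.
have deltaE i : delta_mx i 0 = col i (1%:M : 'M[R]_n).
  by apply/colP => j; rewrite !mxE andbT.
have dd i j : dot (delta_mx i 0) (delta_mx j 0) = (i == j)%:R.
  by rewrite !deltaE dcol// trmx1 mulmx1.
have colM i : col i (reflection w *m k) = reflection w *m col i k.
  by rewrite !colE mulmxA.
have [] := IH (reflection w *m k) (ltnW mn).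
- apply: next => [i im|]; rewrite colM.
    (* For i < i0 the fixed vector e_i is orthogonal to e_i0, and also to k e_i0 because k e_i =
       e_i; hence it is orthogonal to [w]. *)
    rewrite kfix// reflection_orthogonal// dotC dotDr dotNr dd -{1}(kfix _ im).
    by rewrite dcol// subrr.
  by apply: reflection_sub => //; rewrite dcol// dd !eqxx.
- by rewrite trmx_mul reflection_sym -mulmxA (mulmxA (reflection w))
    reflection_invol// mul1mx.
- by move=> Pk; right; exists w.
(* Two odd steps make an even one: k is the product of [reflection w *m reflection v] and
   [reflection v *m reflection w *m k]. *)
- move=> [v v0 Pk]; left.
  have := PM _ _ (PR _ _ w0' v0) Pk.
  by rewrite -!mulmxA (mulmxA (reflection v)) reflection_invol// mul1mx mulmxA
    reflection_invol// mul1mx.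
Qed.

(** The odd alternative would put in [P] a matrix of determinant -1. *)
Lemma SO_reflections (P : set 'M[R]_n) :
  P 1%:M ->
  (forall A B, P A -> P B -> P (A *m B)) ->
  (forall u v, u != 0 -> v != 0 -> P (reflection u *m reflection v)) ->
  (forall A, P A -> \det A = 1) ->
  @SO R n `<=` P.
Proof.
move=> P1 PM PR Pdet k [kk dk].
have [//|[v v0 /Pdet]] := orthogonal_reflections P1 PM PR kk.
rewrite det_mulmx det_reflection// dk; lra.
Qed.

(** A segment between nonzero vectors meets 0 only if they are collinear, and then they define the
    same mirror. This settles the degenerate case of the path of mirrors used below. *)
Lemma reflection_segment u v t : u != 0 -> v != 0 -> u + t *: (v - u) = 0 ->
  reflection u = reflection v.
Proof.
move=> u0 v0 /eqP.
have [->|t0] := eqVneq t 0; first by rewrite scale0r addr0 (negbTE u0).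
rewrite (_ : u + _ = (1 - t) *: u + t *: v); last first.
  by apply/matrixP => i j; rewrite !mxE; ring.
rewrite addr_eq0 -scaleNr => /eqP uv.
have t1 : 1 - t != 0.
  apply/eqP => t1; move: uv => /esym/eqP; rewrite t1 scale0r scaler_eq0 oppr_eq0.
  by rewrite (negbTE t0) (negbTE v0).
by rewrite -(reflectionZ u t1) uv reflectionZ// oppr_eq0.
Qed.

Lemma continuous_reflection (f : R -> 'cV[R]_n) :
  continuous f -> (forall t, f t != 0) -> continuous (fun t => reflection (f t)).
Proof.
move=> cf f0.
have cd : continuous (fun t => dot (f t) (f t)).
  by apply: continuous_entry; apply: continuous_mulmx => //; exact: continuous_trmx.
rewrite /reflection; under eq_fun do rewrite -scaleNr.
apply: continuous_addmx; first exact: cst_continuous.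
apply: continuous_scalemx.
  move=> t; apply: cvgN; apply: cvgMr; apply: cvgV; last exact: cd.
  by rewrite dot_eq0.
by apply: continuous_mulmx => //; exact: continuous_trmx.
Qed.

End reflections.

(** * The identity component contains K and the exponentials *)

Section SO0_group.
Context (R : realType) (p q : nat).
Local Notation I := (Ipq R p q).
Local Notation SOpq := (@SOpq R p q).
Local Notation SO0pq := (@SO0pq R p q).
Local Notation Kpq := (@Kpq R p q).

Lemma SOpq1 : SOpq 1%:M.
Proof. by split; rewrite ?det1// trmx1 mul1mx mulmx1. Qed.

Lemma SOpqM x y : SOpq x -> SOpq y -> SOpq (x *m y).
Proof.
move=> [dx xx] [dy yy]; split; first by rewrite det_mulmx dx dy mulr1.
by rewrite trmx_mul -!mulmxA (mulmxA I) (mulmxA x^T) (mulmxA x^T) xx mulmxA.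
Qed.

Lemma closed_SOpq : closed SOpq.
Proof.
apply: closedI; apply: closed_level_set.
  by apply: continuous_det => x; exact: cvg_id.
apply: continuous_mulmx; last by move=> x; exact: cvg_id.
apply: continuous_mulmx; last exact: cst_continuous.
by apply: continuous_trmx => x; exact: cvg_id.
Qed.

Lemma measurable_SO0pq : measurable SO0pq.
Proof. by apply: closed_mx_measurable; apply: component_closed; exact: closed_SOpq. Qed.

Lemma SO0pq1 : SO0pq 1%:M.
Proof. by apply: connected_component_refl; exact: SOpq1. Qed.

(** The translate of the identity component by x is connected, stays in the group and contains x, so
    it lies in the component of x, which is that of 1. *)
Lemma SO0pqM x y : SO0pq x -> SO0pq y -> SO0pq (x *m y).
Proof.
move=> x0 y0; have xS : SOpq x := connected_component_sub x0.
rewrite /Defs.SO0pq (same_connected_component x0).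
apply: (@connected_component_max _ _ [set x *m z | z in SO0pq]).
- by exists 1%:M; rewrite ?mulmx1//; exact: SO0pq1.
- by move=> _ [z /connected_component_sub zS <-]; exact: SOpqM.
- apply: connected_continuous_connected; first exact: component_connected.
  apply: continuous_subspaceT; apply: continuous_mulmx.
    exact: cst_continuous.
  by move=> z; exact: cvg_id.
- by exists y.
Qed.

Lemma SO0pq_path (f : R -> 'M[R]_(p + q)) : continuous f -> f 0 = 1%:M ->
  (forall t, SOpq (f t)) -> SO0pq (f 1).
Proof.
move=> cf f0 fS; apply: (@connected_component_max _ _ [set f t | t in `[0, 1]]).
- by exists 0 => //=; rewrite in_itv /= lexx ler01.
- by move=> _ [t _ <-].
- apply: connected_continuous_connected; first exact: segment_connected.
  exact: continuous_subspaceT.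
- by exists 1 => //=; rewrite in_itv /= lexx ler01.
Qed.

Lemma Kpq_sub_SOpq : Kpq `<=` SOpq.
Proof.
move=> _ [k [l [[kk dk] [ll dl] ->]]]; split; first by rewrite det_ublock dk dl mulr1.
rewrite tr_block_mx !mulmx_block !trmx0 !(mul0mx, mulmx0, addr0, add0r).
by rewrite mulmxN mulmx1 mulNmx kk mulmx1 ll.
Qed.

Lemma SO1 n : @SO R n 1%:M.
Proof. by split; rewrite ?det1// trmx1 mulmx1. Qed.

Lemma SOM n (k l : 'M[R]_n) : SO k -> SO l -> SO (k *m l).
Proof.
move=> [kk dk] [ll dl]; split; last by rewrite det_mulmx dk dl mulr1.
by rewrite trmx_mul -mulmxA (mulmxA k^T) kk mul1mx.
Qed.

Lemma SO_tr n (k : 'M[R]_n) : SO k -> SO k^T.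
Proof. by move=> [kk dk]; split; rewrite ?det_tr// trmxK; exact: mulmx1C. Qed.

Lemma SO_reflection2 n (u v : 'cV[R]_n) : u != 0 -> v != 0 ->
  SO (reflection u *m reflection v).
Proof.
move=> u0 v0; split.
  rewrite trmx_mul !reflection_sym -mulmxA (mulmxA (reflection u)).
  by rewrite reflection_invol// mul1mx reflection_invol.
by rewrite det_mulmx !det_reflection// mulrNN mulr1.
Qed.

(* phi is one of the two inclusions of SO(p) and SO(q) in K *)
Lemma SO_sub_SO0pq n (phi : 'M[R]_n -> 'M[R]_(p + q)) :
  phi 1%:M = 1%:M -> (forall A B, phi (A *m B) = phi A *m phi B) ->
  (forall A, \det (phi A) = \det A) ->
  (forall f : R -> 'M[R]_n, continuous f -> continuous (phi \o f)) ->
  (forall k, SO k -> Kpq (phi k)) ->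
  forall k, SO k -> SO0pq (phi k).
Proof.
move=> phi1 phiM phidet phic phiK k; move: k.
apply: (@SO_reflections R n [set k | SO0pq (phi k)]) => /=.
- by rewrite phi1; exact: SO0pq1.
- by move=> A B; rewrite phiM; exact: SO0pqM.
- move=> u v u0 v0.
  (* The normal of the second mirror moves from u to v along a segment. If the segment meets 0 the
     two reflections coincide and their product is 1. *)
  have [[t ut]|nt] := pselect (exists t, u + t *: (v - u) = 0).
    rewrite (reflection_segment u0 v0 ut) reflection_invol// phi1.
    exact: SO0pq1.
  have f0 t : u + t *: (v - u) != 0 by apply/eqP => ut; apply: nt; exists t.
  pose f t := phi (reflection u *m reflection (u + t *: (v - u))).
  rewrite (_ : phi _ = f 1); last by rewrite /f scale1r subrKC.
  apply: SO0pq_path.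
  + apply: (phic (fun t => reflection u *m reflection (u + t *: (v - u)))).
    apply: continuous_mulmx; first exact: cst_continuous.
    apply: continuous_reflection => //.
    apply: continuous_addmx; first exact: cst_continuous.
    by apply: continuous_scalemx; [move=> t; exact: cvg_id|exact: cst_continuous].
  + by rewrite /f scale0r addr0 reflection_invol.
  + by move=> t; apply: Kpq_sub_SOpq; apply: phiK; exact: SO_reflection2.
- by move=> A /connected_component_sub [<- _].
Qed.

Lemma Kpq_sub_SO0pq : Kpq `<=` SO0pq.
Proof.
move=> _ [k [l [kS lS ->]]].
have -> : block_mx k 0 0 l = block_mx k 0 0 1%:M *m block_mx 1%:M 0 0 l.
  by rewrite mulmx_block !(mul0mx, mulmx0, addr0, add0r) mulmx1 mul1mx.
apply: SO0pqM.
- apply: (@SO_sub_SO0pq _ (fun k => block_mx k 0 0 1%:M)) kS.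
  + by rewrite -scalar_mx_block.
  + by move=> A B; rewrite mulmx_block !(mul0mx, mulmx0, addr0, add0r) mulmx1.
  + by move=> A; rewrite det_ublock det1 mulr1.
  + by move=> f cf; apply: continuous_block_mx => //; exact: cst_continuous.
  + by move=> A AS; exists A, 1%:M; split => //; exact: SO1.
- apply: (@SO_sub_SO0pq _ (fun k => block_mx 1%:M 0 0 k)) lS.
  + by rewrite -scalar_mx_block.
  + by move=> A B; rewrite mulmx_block !(mul0mx, mulmx0, addr0, add0r) mulmx1.
  + by move=> A; rewrite det_ublock det1 mul1r.
  + by move=> f cf; apply: continuous_block_mx => //; exact: cst_continuous.
  + by move=> A AS; exists 1%:M, A; split => //; exact: SO1.
Qed.

Lemma KpqM k l : Kpq k -> Kpq l -> Kpq (k *m l).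
Proof.
move=> [a [b [aS bS ->]]] [a' [b' [aS' bS' ->]]].
exists (a *m a'), (b *m b'); split; [exact: SOM|exact: SOM|].
by rewrite mulmx_block !(mul0mx, mulmx0, addr0, add0r).
Qed.

Lemma Kpq_tr k : Kpq k -> Kpq k^T.
Proof.
move=> [a [b [aS bS ->]]]; exists a^T, b^T; split; [exact: SO_tr|exact: SO_tr|].
by rewrite tr_block_mx !trmx0.
Qed.

Lemma Kpq_orthogonal k : Kpq k -> k^T *m k = 1%:M.
Proof.
move=> [a [b [[aa _] [bb _] ->]]]; rewrite tr_block_mx mulmx_block.
by rewrite !trmx0 !(mul0mx, mulmx0, addr0, add0r) aa bb -scalar_mx_block.
Qed.

Lemma closed_SO n : closed (@SO R n).
Proof.
apply: closedI; apply: closed_level_set.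
  by apply: continuous_mulmx; [apply: continuous_trmx|]; move=> x; exact: cvg_id.
by apply: continuous_det => x; exact: cvg_id.
Qed.

Lemma measurable_Kpq : measurable Kpq.
Proof.
apply: closed_mx_measurable.
have -> : Kpq = (@ulsubmx R p q p q @^-1` @SO R p) `&` (drsubmx @^-1` @SO R q) `&`
    ([set g | ursubmx g = 0] `&` [set g | dlsubmx g = 0]).
  apply/seteqP; split => [_ [k [l [kS lS ->]]]|g [[gS gS'] [ur dl]]].
    by rewrite /= block_mxKul block_mxKur block_mxKdl block_mxKdr.
  exists (ulsubmx g), (drsubmx g); split => //.
  by rewrite -[LHS]submxK ur dl.
apply: closedI; apply: closedI.
- have /continuous_closedP : continuous (@ulsubmx R p q p q).
    by apply: continuous_mx => i j; under eq_fun do rewrite !mxE;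
      exact: coord_continuous.
  by apply; exact: closed_SO.
- have /continuous_closedP : continuous (@drsubmx R p q p q).
    by apply: continuous_mx => i j; under eq_fun do rewrite !mxE;
      exact: coord_continuous.
  by apply; exact: closed_SO.
- apply: closed_level_set; apply: continuous_mx => i j.
  by under eq_fun do rewrite !mxE; exact: coord_continuous.
- apply: closed_level_set; apply: continuous_mx => i j.
  by under eq_fun do rewrite !mxE; exact: coord_continuous.
Qed.

(** The path sending t to e^(tH) joins 1 to e^H inside the group. *)
Lemma cartan_exp_SO0pq (H : 'rV[R]_p) : (p <= q)%N -> SO0pq (cartan_exp q H).
Proof.
move=> hpq.
have specZ t : cartan_spec q (t *: H) = t *: cartan_spec q H.
  rewrite /cartan_spec scale_row_mx; congr row_mx; apply/rowP => j; rewrite !mxE.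
  by case: insubP => [i _ _|_] /=; [rewrite mxE mulrN|rewrite oppr0 mulr0].
pose f t := cartan_exp q (t *: H).
rewrite (_ : cartan_exp q H = f 1); last by rewrite /f scale1r.
apply: SO0pq_path.
- rewrite /f; under eq_fun do rewrite cartan_expE// specZ.
  apply: continuous_mulmx; last exact: cst_continuous.
  apply: continuous_mulmx; first exact: cst_continuous.
  move: (cartan_spec q H) => d.
  apply: continuous_mx => i j; under eq_fun do rewrite !mxE.
  case: eqP => _ /=; last exact: cst_continuous.
  rewrite (_ : (fun t => _) = expR \o (fun t => t * d ord0 i)); last first.
    by apply/funext => t; rewrite mulr1n.
  move=> t; apply: continuous_comp; last exact: continuous_expR.
  exact: mulrr_continuous.
- rewrite /f cartan_expE// specZ scale0r (_ : map_mx _ _ = const_mx 1).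
    by rewrite diag_const_mx mulmx1 cartan_basis_invol.
  by apply/rowP => j; rewrite !mxE expR0.
- move=> t; have EE := cartan_exp_Ipq hpq (t *: H).
  split; last by rewrite /f trmx_cartan_exp.
  have I0 : \det I != 0.
    rewrite det_ublock det1 mulr1 -scaleN1r detZ det1 mulr1.
    by rewrite expf_neq0// oppr_eq0 oner_eq0.
  (* Preserving the form forces the determinant to have square 1; its positivity excludes -1. *)
  have := congr1 determinant EE; rewrite !det_mulmx mulrAC => /(canRL (mulfK I0)).
  rewrite divff// => /eqP; rewrite -expr2 sqrf_eq1 => /orP[/eqP//|/eqP dE].
  by have := det_cartan_exp_gt0 hpq (t *: H); rewrite dE; lra.
Qed.

End SO0_group.

(** * Lebesgue-null unions of hyperplanes *)

Section null_sets.
Context (R : realType).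

Definition abs_level n (x : R) : set 'rV[R]_n :=
  [set H | exists i, `|H ord0 i| = x].

(** The set is closed, as the zero set of the continuous product of the |H_i| - x. *)
Lemma measurable_abs_level n x : measurable (@abs_level n x).
Proof.
apply: closed_mx_measurable.
rewrite (_ : abs_level _ = [set H | \prod_i (`|H ord0 i| - x) = 0]).
  apply: closed_level_set; apply: continuous_prodr => i H.
  exact: (cvgB (cvg_norm (@coord_continuous _ _ _ ord0 i H)) (cvg_cst _)).
apply/seteqP; split => H /=.
  by move=> [i Hi]; apply/eqP/prodf_eq0; exists i; rewrite // Hi subrr.
by move=> /eqP/prodf_eq0[i _]; rewrite subr_eq0 => /eqP Hi; exists i.
Qed.

(** Induction on the dimension: either the first coordinate is x or -x, a null condition on the
    line, or the remaining coordinates already lie in the level set. *)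
Lemma lebesgue_abs_level n x : lebesgue_rV n (@abs_level n x) = 0%E.
Proof.
elim: n => [|n IH].
  by rewrite (_ : abs_level _ = set0) ?measure0// -subset0 => H [[]].
rewrite /= /lebesgue_cons /pushforward.
pose C : set R := [set x] `|` [set - x].
have mC : measurable C by exact: measurableU.
have C0 : lebesgue_measure C = 0%E.
  by rewrite measureU0//; exact: lebesgue_measure_set1.
have sub : @rV_cons R n @^-1` abs_level x `<=`
    (C `*` setT) `|` (setT `*` abs_level x).
  move=> [y v] [i]; rewrite /rV_cons /=.
  case: (@split_ordP 1 n i) => k ->.
    rewrite (@row_mxEl R 1 1 n) !ord1 mxE eqxx mulr1n => yx; left; split => //=.
    have [y0|y0] := leP 0 y.
      by left; rewrite /= -yx ger0_norm.
    by right; rewrite /= -yx ltr0_norm// opprK.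
  by rewrite (@row_mxEr R 1 1 n) => vx; right; split => //; exists k.
have m1 : measurable (C `*` (setT : set 'rV[R]_n)) by exact: measurableX.
have m2 : measurable ((setT : set (measurableTypeR R)) `*` @abs_level n x).
  by apply: measurableX => //; exact: measurable_abs_level.
have e1 : (lebesgue_measure \x lebesgue_rV n)%E (C `*` setT) = 0%E.
  by rewrite product_measure1E// [X in (X * _)%E]C0 mul0e.
have e2 : (lebesgue_measure \x lebesgue_rV n)%E (setT `*` abs_level x) = 0%E.
  rewrite product_measure1E//; last exact: measurable_abs_level.
  by rewrite [X in (_ * X)%E]IH mule0.
apply/eqP; rewrite -measure_le0.
apply: le_trans (_ : _ <= (lebesgue_measure \x lebesgue_rV n)%E
  ((C `*` setT) `|` (setT `*` abs_level x)))%E _.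
  apply: le_measure => //; rewrite inE; last exact: measurableU.
  by rewrite -[X in measurable X]setTI; apply: measurable_funP => //;
    exact: measurable_abs_level.
by rewrite measureU0// [X in (X <= _)%E]e1.
Qed.

End null_sets.

(** * Configurations and multiplicities *)

Section configurations.
Context (R : realType) (p : nat).
Implicit Types (X : 'rV[R]_p).

Definition mult X (x : R) : nat := #|[set i | `|X ord0 i| == x]%SET|.

Lemma count_abs_entries X x : count_mem x (abs_entries X) = mult X x.
Proof.
rewrite /abs_entries; have /permP -> := permEl (perm_sort >=%R [seq `|X ord0 i| | i : 'I_p]).
rewrite count_map /mult cardsE cardE -size_filter /enum_mem -enumT.
rewrite -filter_predI; congr size; apply: eq_filter => i.
by rewrite /= !inE andbT.
Qed.

Lemma bigmaxn_mem (s : seq nat) : (\max_(i <- s) i = 0 \/ \max_(i <- s) i \in s)%N.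
Proof.
elim: s => [|x s IH]; first by left; rewrite big_nil.
right; rewrite big_cons inE; case: (leqP (\max_(j <- s) j) x) => [_|lt].
  by rewrite eqxx.
case: IH => [m0|->]; last by rewrite orbT.
by rewrite m0 in lt.
Qed.

(** Unless 2u attains the maximum, max(s) exceeds 2u, so it is positive and is the multiplicity of
    some x > 0; positivity also rules out the list [0] attached to X = 0. *)
Lemma max_configuration X s u : configuration X = (s, u) ->
  max_conf s (2 * u) = (2 * mult X 0%R)%N \/
  exists2 x, 0 < x & max_conf s (2 * u) = mult X x.
Proof.
rewrite /configuration => -[sE uE]; rewrite count_abs_entries in uE.
rewrite -uE /max_conf; case: leqP => lt; first by left.
right; have [m0|] := bigmaxn_mem s; first by rewrite m0 in lt.
rewrite -{2}sE; case: ifP => X0.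
  by rewrite inE => /eqP m0; rewrite m0 in lt.
move=> /mapP[x]; rewrite mem_filter => /andP[x0].
rewrite mem_undup mem_sort => /mapP[i _ xE] ->.
by exists x; [rewrite lt_neqAle eq_sym x0 xE normr_ge0|rewrite count_abs_entries].
Qed.

Lemma mult_le X x : (mult X x <= p)%N.
Proof. by rewrite -[leqRHS]card_ord; exact: max_card. Qed.

End configurations.

(** * Spectrum of e^(2H) and ranks of its shifts *)

Section ranks.
Context (R : realType) (p q : nat).
Hypothesis hpq : (p <= q)%N.

(** Each nonzero entry contributes an elementary matrix, of rank one. *)
Lemma rank_diag_mx n (d : 'rV[R]_n) :
  (\rank (diag_mx d) <= #|[set j | d ord0 j != 0%R]%SET|)%N.
Proof.
rewrite diag_mx_sum_delta (bigID (fun j => d ord0 j != 0)) /=.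
rewrite [X in _ + X]big1 ?addr0; last by move=> j /negbNE/eqP ->; rewrite scale0r.
rewrite cardsE -sum1_card.
elim/big_rec2: _ => [|j m M _ IH]; first by rewrite mxrank0.
apply: leq_trans (mxrank_add _ _) _; apply: leq_add => //.
by apply: leq_trans (mxrank_scale _ _) _; rewrite mxrank_delta.
Qed.

Lemma cartan_exp_sqr_sub (H : 'rV[R]_p) (x : R) :
  cartan_exp q H *m cartan_exp q H - (expR (x + x))%:M = cartan_basis R p q *m
    diag_mx (map_mx (fun d => expR (d + d) - expR (x + x)) (cartan_spec q H)) *m
    cartan_basis R p q.
Proof.
have UU := cartan_basis_invol R hpq.
rewrite cartan_expE// -!mulmxA (mulmxA (cartan_basis _ _ _) (cartan_basis _ _ _)).
rewrite UU mul1mx.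
rewrite (mulmxA (diag_mx _)) mulmx_diag.
rewrite [in LHS](_ : (expR (x + x))%:M = cartan_basis R p q *m
   (diag_mx (const_mx (expR (x + x))) *m cartan_basis R p q)); last first.
  by rewrite diag_const_mx mul_scalar_mx -scalemxAr UU scalemx1.
rewrite -mulmxBr -mulmxBl -raddfB /=; congr (_ *m (diag_mx _ *m _)).
by move: (cartan_spec q H) => d; apply/rowP => j; rewrite !mxE -expRD.
Qed.

(** The eigenvalues of e^(2H) are the e^(2 H_i), e^(-2 H_i) and 1. Since x > 0, the eigenvalue 1
    cannot equal e^(2x), and H_i = x or -H_i = x amounts to |H_i| = x. *)
Lemma det_cartan_exp_sqr_sub (H : 'rV[R]_p) (x : R) : 0 < x ->
  \det (cartan_exp q H *m cartan_exp q H - (expR (x + x))%:M) = 0 <->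
  abs_level x H.
Proof.
move=> x0; rewrite cartan_exp_sqr_sub !det_mulmx mulrAC -det_mulmx.
rewrite cartan_basis_invol// det1 mul1r det_diag.
have dbl y : (expR (y + y) - expR (x + x) == 0) = (y == x).
  by rewrite subr_eq0 (inj_eq (@expR_inj R)); apply/eqP/eqP; lra.
split.
  move=> /eqP/prodf_eq0[j _]; rewrite mxE dbl; case: (split_ordP j) => i ->.
    by rewrite row_mxEl => /eqP Hi; exists i; rewrite Hi gtr0_norm.
  rewrite row_mxEr !mxE; case: insubP => [k _ _|_] /=.
    by move=> /eqP Hi; exists k; rewrite -normrN Hi gtr0_norm.
  by rewrite oppr0 lt_eqF.
move=> [i Hi]; apply/eqP/prodf_eq0; have [H0|H0] := leP 0 (H ord0 i).
  by exists (lshift q i) => //; rewrite mxE dbl row_mxEl -Hi ger0_norm.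
exists (rshift p (widen_ord hpq i)) => //.
by rewrite mxE dbl row_mxEr mxE cartan_pad_widen -Hi ltr0_norm.
Qed.

Lemma rank_cartan_exp_sqr_sub (H : 'rV[R]_p) (x : R) : 0 < x ->
  (\rank (cartan_exp q H *m cartan_exp q H - (expR (x + x))%:M)%R
    <= p + q - mult H x)%N.
Proof.
move=> x0; rewrite cartan_exp_sqr_sub.
apply: leq_trans (mxrankM_maxl _ _) _; apply: leq_trans (mxrankM_maxr _ _) _.
apply: leq_trans (rank_diag_mx _) _.
rewrite leq_subRL; last by apply: leq_trans (mult_le H x) _; exact: leq_addr.
(* Of the two positions carrying H_i and -H_i, [phi] picks the one carrying |H_i|. Those with |H_i|
   = x have a zero diagonal entry, so their number and that of the nonzero entries add up to at most
   p + q. *)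
pose phi (i : 'I_p) : 'I_(p + q) :=
  if 0 <= H ord0 i then lshift q i else rshift p (widen_ord hpq i).
have phi_inj : injective phi.
  move=> i j /(congr1 val); rewrite /phi.
  case: ifP => _; case: ifP => _ /= ij; apply: val_inj => //=.
  - by have := ltn_ord i; rewrite ij ltnNge leq_addr.
  - by have := ltn_ord j; rewrite -ij ltnNge leq_addr.
  - exact: addnI ij.
rewrite /mult -(card_imset _ phi_inj) -[X in (_ <= X)%N]card_ord.
rewrite -cardsUI [X in (_ + X)%N](_ : _ = 0%N) ?addn0 ?max_card//.
apply/eqP; rewrite cards_eq0 -finset.subset0; apply/fintype.subsetP => j.
rewrite !inE => /andP[/imsetP[i + ->]]; rewrite inE => /eqP Hi /negP[].
rewrite mxE subr_eq0 (inj_eq (@expR_inj R)) /phi -Hi.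
case: ifPn => H0; first by rewrite row_mxEl ger0_norm.
by rewrite row_mxEr mxE cartan_pad_widen ltr0_norm// ltNge.
Qed.

(** At x = 0 only the nonzero H_i matter, each through its two eigenvalues; the vanishing
    coordinates and the padding give e^0 - 1 = 0. *)
Lemma rank_cartan_exp_sqr_sub1 (H : 'rV[R]_p) :
  (\rank (cartan_exp q H *m cartan_exp q H - 1%:M)%R <= 2 * (p - mult H 0%R))%N.
Proof.
have := cartan_exp_sqr_sub H 0; rewrite addr0 expR0 => ->.
apply: leq_trans (mxrankM_maxl _ _) _; apply: leq_trans (mxrankM_maxr _ _) _.
apply: leq_trans (rank_diag_mx _) _.
set A := [set i : 'I_p | H ord0 i != 0]%SET.
have Ac : (#|A| <= p - mult H 0%R)%N.
  rewrite leq_subRL ?mult_le// -[X in (_ <= X)%N](card_ord p) /mult.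
  rewrite -cardsUI [X in (_ + X)%N](_ : _ = 0%N) ?addn0 ?max_card//.
  apply/eqP; rewrite cards_eq0 -finset.subset0; apply/fintype.subsetP => i.
  by rewrite !inE normr_eq0 andbN.
apply: leq_trans (_ : #|(@lshift p q @: A) :|: (@rshift p q \o widen_ord hpq) @: A|%SET
  <= _)%N; last first.
  rewrite mul2n -addnn; apply: leq_trans (leq_card_setU _ _) _.
  by apply: leq_add; apply: leq_trans (leq_imset_card _ _) _.
apply: subset_leq_card; apply/fintype.subsetP => j; rewrite !inE mxE => dj.
case: (split_ordP j) dj => i ->.
  rewrite row_mxEl => dj; apply/orP; left; apply: imset_f; rewrite inE.
  by apply: contraNN dj => /eqP ->; rewrite addr0 expR0 subrr.
rewrite row_mxEr mxE => dj; apply/orP; right.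
have [ip|ip] := ltnP i p; last first.
  by move: dj; rewrite cartan_pad_out// oppr0 addr0 expR0 subrr eqxx.
have iE : i = widen_ord hpq (Ordinal ip) by exact: val_inj.
apply/imsetP; exists (Ordinal ip); last by rewrite /= -iE.
rewrite inE; apply: contraNN dj => /eqP H0.
by rewrite iE cartan_pad_widen H0 oppr0 addr0 expR0 subrr.
Qed.

End ranks.

(** * Determinants detecting H, and their vanishing on products *)

Section cartan_products.
Context (R : realType) (p q : nat).
Hypothesis hpq : (p <= q)%N.
Local Notation E := (@cartan_exp R p q).
Local Notation Kpq := (@Kpq R p q).

Lemma det_rank_lt n (A : 'M[R]_n) : (\rank A < n)%N -> \det A = 0.
Proof.
move=> rA; apply/eqP; apply: contraLR rA => dA; rewrite -leqNgt.
have : A \in unitmx by rewrite unitmxE unitfE.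
by rewrite -row_full_unit => /eqP ->.
Qed.

Lemma ursubmx_Kpq k1 k2 (g : 'M[R]_(p + q)) : Kpq k1 -> Kpq k2 ->
  exists a b, [/\ \det a = 1, b *m b^T = 1%:M &
    ursubmx (k1 *m g *m k2) = a *m ursubmx g *m b].
Proof.
move=> [a [b [[_ da] _ ->]]] [a' [b' [_ [bb _] ->]]].
exists a, b'; split => //; first exact: mulmx1C.
rewrite -{1}[g]submxK !mulmx_block block_mxKur.
by rewrite !(mul0mx, mulmx0, addr0, add0r).
Qed.

(** The block is not square, hence the Gram matrix. The orthogonal factors drop out and its
    determinant is the product of the squares of sinh H_i. *)
Lemma det_ursubmx_gram k1 k2 (H : 'rV[R]_p) : Kpq k1 -> Kpq k2 ->
  \det (ursubmx (k1 *m E H *m k2) *m (ursubmx (k1 *m E H *m k2))^T) = 0 <->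
  abs_level 0 H.
Proof.
move=> K1 K2; have [a [b [da bb ->]]] := ursubmx_Kpq (E H) K1 K2.
rewrite ursubmx_cartan_exp// -diag_mx_pid; set h := map_mx _ H.
have -> : a *m (diag_mx h *m pid_mx p) *m b *m
    (a *m (diag_mx h *m pid_mx p) *m b)^T =
    a *m diag_mx h *m (a *m diag_mx h)^T :> 'M[R]_p.
  rewrite !trmx_mul -!mulmxA (mulmxA b) bb mul1mx (mulmxA (pid_mx p)).
  by rewrite tr_pid_mx mul_pid_mx minnn (minn_idPr hpq) pid_mx_1 mul1mx.
rewrite !det_mulmx det_tr det_mulmx da !mul1r det_diag.
have h0 i : (h ord0 i == 0) = (`|H ord0 i| == 0).
  rewrite mxE mulf_eq0 invr_eq0 pnatr_eq0 orbF subr_eq0 (inj_eq (@expR_inj R)).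
  by rewrite normr_eq0; apply/eqP/eqP; lra.
split.
  move=> /eqP; rewrite mulf_eq0 orbb => /prodf_eq0[i _].
  by rewrite h0 => /eqP; exists i.
move=> [i Hi]; apply/eqP; rewrite mulf_eq0 orbb; apply/prodf_eq0.
by exists i => //; rewrite h0 Hi.
Qed.

Lemma rank_ursubmx_cartan_exp (H : 'rV[R]_p) :
  (\rank (ursubmx (E H)) <= p - mult H 0%R)%N.
Proof.
rewrite ursubmx_cartan_exp// -diag_mx_pid.
apply: leq_trans (mxrankM_maxl _ _) _; apply: leq_trans (rank_diag_mx _) _.
rewrite leq_subRL ?mult_le// -[X in (_ <= X)%N](card_ord p) /mult.
rewrite -cardsUI [X in (_ + X)%N](_ : _ = 0%N) ?addn0 ?max_card//.
apply/eqP; rewrite cards_eq0 -finset.subset0; apply/fintype.subsetP => i.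
rewrite !inE normr_eq0 mxE => /andP[/eqP -> /negP[]].
by rewrite oppr0 subrr mul0r.
Qed.

Lemma det_ursubmx_gram_product k1 k2 k3 (X Y : 'rV[R]_p) :
  Kpq k1 -> Kpq k2 -> Kpq k3 -> (p < mult X 0%R + mult Y 0%R)%N ->
  let g := k1 *m E X *m k2 *m E Y *m k3 in
  \det (ursubmx g *m (ursubmx g)^T) = 0.
Proof.
move=> K1 [a [b [_ _ k2E]]] K3 uv g.
have -> : g = k1 *m (E X *m k2 *m E Y) *m k3 by rewrite /g !mulmxA.
have [c [d [_ _ ->]]] := ursubmx_Kpq (E X *m k2 *m E Y) K1 K3.
apply: det_rank_lt; apply: leq_ltn_trans (mxrankM_maxl _ _) _.
apply: leq_ltn_trans (mxrankM_maxl _ _) _.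
apply: leq_ltn_trans (mxrankM_maxr _ _) _.
(* As [k2] is block diagonal, each summand contains the upper right block of exactly one of e^X and
   e^Y, which bounds its rank. *)
have -> : ursubmx (E X *m k2 *m E Y) =
    ulsubmx (E X) *m a *m ursubmx (E Y) + ursubmx (E X) *m b *m drsubmx (E Y).
  rewrite -{1}[E X]submxK -{1}[E Y]submxK k2E !mulmx_block block_mxKur.
  by rewrite !(mul0mx, mulmx0, addr0, add0r).
apply: leq_ltn_trans (mxrank_add _ _) _.
have r1 : (\rank (ulsubmx (E X) *m a *m ursubmx (E Y)) <= p - mult Y 0%R)%N.
  by apply: leq_trans (mxrankM_maxr _ _) _; exact: rank_ursubmx_cartan_exp.
have r2 : (\rank (ursubmx (E X) *m b *m drsubmx (E Y)) <= p - mult X 0%R)%N.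
  rewrite -mulmxA; apply: leq_trans (mxrankM_maxl _ _) _.
  exact: rank_ursubmx_cartan_exp.
have := mult_le X 0; have := mult_le Y 0; lia.
Qed.

Lemma gram_sub k (M : 'M[R]_(p + q)) c : Kpq k ->
  k *m M *m k^T - c%:M = k *m (M - c%:M) *m k^T.
Proof.
move=> /Kpq_orthogonal/mulmx1C kk.
by rewrite mulmxBr mulmxBl mul_mx_scalar -scalemxAl kk scalemx1.
Qed.

Lemma det_conj_Kpq k (M : 'M[R]_(p + q)) : Kpq k -> \det (k *m M *m k^T) = \det M.
Proof.
move=> /Kpq_orthogonal kk; rewrite !det_mulmx mulrAC -det_mulmx.
by rewrite (mulmx1C kk) det1 mul1r.
Qed.

(** The factor [k2] cancels in g g^T, which is thus the conjugate of e^(2H) by [k1]. *)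
Lemma det_gram_sub k1 k2 (H : 'rV[R]_p) (x : R) : Kpq k1 -> Kpq k2 -> 0 < x ->
  \det ((k1 *m E H *m k2) *m (k1 *m E H *m k2)^T - (expR (x + x))%:M) = 0 <->
  abs_level x H.
Proof.
move=> K1 K2 x0; rewrite -(det_cartan_exp_sqr_sub hpq H x0).
rewrite !trmx_mul trmx_cartan_exp// -!mulmxA (mulmxA k2).
rewrite (mulmx1C (Kpq_orthogonal K2)) mul1mx (mulmxA (E H)) mulmxA.
by rewrite gram_sub// det_conj_Kpq.
Qed.

Lemma det_gram_product k1 k2 k3 (X Y : 'rV[R]_p) (x : R) :
  Kpq k1 -> Kpq k2 -> Kpq k3 -> 0 < x ->
  (2 * p < mult X x + 2 * mult Y 0%R)%N ->
  let g := k1 *m E X *m k2 *m E Y *m k3 in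
  \det (g *m g^T - (expR (x + x))%:M) = 0.
Proof.
move=> K1 K2 K3 x0 sv g; set c := expR _.
have gg : g *m g^T = k1 *m (E X *m (k2 *m (E Y *m E Y) *m k2^T) *m E X) *m k1^T.
  rewrite /g !trmx_mul !trmx_cartan_exp// -!mulmxA (mulmxA k3).
  by rewrite (mulmx1C (Kpq_orthogonal K3)) mul1mx.
rewrite gg gram_sub// det_conj_Kpq//.
set M := k2 *m _ *m _.
have -> : E X *m M *m E X - c%:M = E X *m (M - 1%:M) *m E X + (E X *m E X - c%:M).
  by rewrite mulmxBr mulmx1 mulmxBl addrA subrK.
have rM : (\rank (M - 1%:M)%R <= 2 * (p - mult Y 0%R))%N.
  rewrite gram_sub//; apply: leq_trans (mxrankM_maxl _ _) _.
  by apply: leq_trans (mxrankM_maxr _ _) _; exact: rank_cartan_exp_sqr_sub1.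
have rX := rank_cartan_exp_sqr_sub hpq X x0.
apply: det_rank_lt; apply: leq_ltn_trans (mxrank_add _ _) _.
have rE : (\rank (E X *m (M - 1%:M) *m E X)%R <= \rank (M - 1%:M)%R)%N.
  by apply: leq_trans (mxrankM_maxl _ _) _; exact: mxrankM_maxr.
rewrite -/c in rX.
(* The total rank is at most 2 (p - v) + (p + q - s), which is below p + q because s + 2v > 2p. *)
have := mult_le X x; have := mult_le Y 0; lia.
Qed.

End cartan_products.

(** * Support of the measure and the criterion for singularity *)

Section full_support.
Context (R : realType) (p q : nat).
Local Notation E := (@cartan_exp R p q).
Local Notation Kpq := (@Kpq R p q).

(** Since [mK] gives mass one to K, this is [full_convolution] applied repeatedly, the two adjacent
    inner factors in K being merged into one. *)
Lemma full_mXY (mK : probability 'M[R]_(p + q) R) (X Y : 'rV[R]_p) :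
  is_haar_K mK ->
  full (mXY mK X Y) [set g | exists k1 k2 k3,
    [/\ Kpq k1, Kpq k2, Kpq k3 & g = k1 *m E X *m k2 *m E Y *m k3]].
Proof.
move=> [mK1 _]; have fK := full_measurable (@measurable_Kpq R p q) mK1.
have fd Z : full (delta_natural mK Z) [set g | exists k1 k2,
    [/\ Kpq k1, Kpq k2 & g = k1 *m E Z *m k2]].
  have := full_convolution (full_convolution fK (@full_dirac R _ (E Z))) fK.
  move=> fZ C mC KC; apply: fZ => // _ [_ [k2 [[k1 [_ [K1 -> ->]]] K2 ->]]].
  by apply: KC; exists k1, k2.
have fXY := full_convolution (fd X) (fd Y).
move=> C mC KC; apply: fXY => //.
move=> _ [_ [_ [[k1 [k2 [K1 K2 ->]]] [k3 [k4 [K3 K4 ->]]] ->]]].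
apply: KC; exists k1, (k2 *m k3), k4; split => //; first exact: KpqM.
by rewrite !mulmxA.
Qed.

(** The closed set [Z] expresses |H_i| = x directly on g, so within the group it is the preimage of
    the level set under [a]; this is what makes that preimage measurable. It has mass one, while the
    level set is Lebesgue-null. *)
Lemma muXY_not_dominated (hpq : (p <= q)%N)
    (mK : probability 'M[R]_(p + q) R) (a : 'M[R]_(p + q) -> 'rV[R]_p)
    (X Y : 'rV[R]_p) (x : R) (Z : set 'M[R]_(p + q)) :
  is_haar_K mK -> is_cartan_projection a -> closed Z ->
  (forall k1 k2 H, Kpq k1 -> Kpq k2 -> Z (k1 *m E H *m k2) <-> abs_level x H) ->
  (forall k1 k2 k3, Kpq k1 -> Kpq k2 -> Kpq k3 ->
    Z (k1 *m E X *m k2 *m E Y *m k3)) ->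
  ~ (muXY mK a X Y `<< lebesgue_rV p).
Proof.
move=> hK ha cZ ZH ZXY dom.
have : muXY mK a X Y (@abs_level R p x) = 0%E.
  apply: (dom (@abs_level R p x)) => //; last exact: measurable_abs_level.
  move=> A mA AN; apply/eqP; rewrite -measure_le0 -(lebesgue_abs_level p x).
  by apply: le_measure => //; rewrite inE//; exact: measurable_abs_level.
rewrite /muXY.
have -> : SO0pq (p := p) (q := q) `&` a @^-1` @abs_level R p x =
    @SO0pq R p q `&` Z.
  apply/seteqP; split => g [gS]; have [_ [k1 [k2 [K1 K2 gE]]]] := ha g gS.
    by move=> ag; split => //; rewrite gE; exact/ZH.
  by rewrite {1}gE => Zg; split => //=; exact/(ZH k1 k2).
rewrite (full_mXY hK) => [/eqP||g [k1 [k2 [k3 [K1 K2 K3 ->]]]]].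
- by rewrite onee_eq0.
- apply: measurableI; first exact: measurable_SO0pq.
  exact: closed_mx_measurable.
- split; last exact: ZXY.
  by do !apply: SO0pqM; first [exact: Kpq_sub_SO0pq|exact: cartan_exp_SO0pq].
Qed.

End full_support.

(** * Conclusion: the cases of non-eligibility *)

Lemma closed_gram_sub (R : realType) n (c : R) :
  closed [set g : 'M[R]_n | \det (g *m g^T - c%:M) = 0].
Proof.
apply: closed_level_set; apply: continuous_det; apply: continuous_addmx.
  apply: continuous_mulmx; first by move=> g; exact: cvg_id.
  by apply: continuous_trmx => g; exact: cvg_id.
exact: cst_continuous.
Qed.

Theorem proposition5 (R : realType) (p q : nat) (hp : (1 <= p)%N)
    (hpq : (p < q)%N)
    (mK : probability 'M[R]_(p + q) R) (hK : is_haar_K mK)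
    (a : 'M[R]_(p + q) -> 'rV[R]_p) (ha : is_cartan_projection a)
    (X Y : 'rV[R]_p) (s t : seq nat) (u v : nat)
    (hX : configuration X = (s, u)) (hY : configuration Y = (t, v))
    (not_eligible :
      (2 * p < max_conf s (2 * u) + max_conf t (2 * v))%N) :
  ~ (muXY mK a X Y `<< lebesgue_rV p).
Proof.
have pq : (p <= q)%N := ltnW hpq.
move: not_eligible.
case: (max_configuration hX) => [->|[x x0 ->]];
  case: (max_configuration hY) => [->|[y y0 ->]] ne.
(* Both maxima come from the zeros, so u + v > p and some H_i must vanish. *)
- apply: (@muXY_not_dominated _ _ _ pq _ _ _ _ 0
    [set g | \det (ursubmx g *m (ursubmx g)^T) = 0]) => //.
  + apply: closed_level_set; apply: continuous_det.
    have cu : continuous (@ursubmx R p q p q).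
      apply: continuous_mx => i j; under eq_fun do rewrite !mxE.
      exact: coord_continuous.
    by apply: continuous_mulmx => //; exact: continuous_trmx.
  + by move=> k1 k2 H K1 K2; exact: det_ursubmx_gram.
  + by move=> k1 k2 k3 K1 K2 K3; apply: det_ursubmx_gram_product => //; lia.
(* Transposition reverses the product and exchanges the roles of X and Y, reducing to the case where
   the positive value belongs to the first factor. *)
- apply: (@muXY_not_dominated _ _ _ pq _ _ _ _ y
    (@trmx R _ _ @^-1` [set g | \det (g *m g^T - (expR (y + y))%:M) = 0])) => //.
  + have /continuous_closedP : continuous (@trmx R (p + q) (p + q)).
      by apply: continuous_trmx => g; exact: cvg_id.
    by apply; exact: closed_gram_sub.
  + move=> k1 k2 H K1 K2; rewrite /preimage /=.
    rewrite (_ : (_ *m _ *m _)^T = k2^T *m cartan_exp q H *m k1^T).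
      by apply: det_gram_sub => //; exact: Kpq_tr.
    by rewrite !trmx_mul trmx_cartan_exp// mulmxA.
  + move=> k1 k2 k3 K1 K2 K3; rewrite /preimage /=.
    rewrite (_ : (_ *m _ *m _)^T =
      k3^T *m cartan_exp q Y *m k2^T *m cartan_exp q X *m k1^T).
      by apply: det_gram_product => //; [exact: Kpq_tr..|lia].
    by rewrite !trmx_mul !trmx_cartan_exp// !mulmxA.
- apply: (@muXY_not_dominated _ _ _ pq _ _ _ _ x
    [set g | \det (g *m g^T - (expR (x + x))%:M) = 0]) => //.
  + exact: closed_gram_sub.
  + by move=> k1 k2 H K1 K2; exact: det_gram_sub.
  + by move=> k1 k2 k3 K1 K2 K3; exact: det_gram_product.
(* Two multiplicities of positive values are at most p each, so their sum cannot exceed 2p. *)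
- by have := mult_le X x; have := mult_le Y y; lia.
Qed.
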